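(* Let $q\in\mathbb{C}$ with $q\neq 0,\pm 1$. In $U_q(\mathfrak{sl}_2)\otimes C(\mathfrak{p})$, the square of the Dirac operator $D=E\otimes c(F_0)+F\otimes c(E_0)$ is $$D^2=\tfrac12\,\mathrm{Cas}_q\otimes 1-\frac{1}{q+q^{-1}}\,\delta(\mathrm{Cas}_q(\mathfrak{k}))+\frac{q+q^{-1}-2}{(q-q^{-1})^2}\otimes 1.$$
   Context: $U_q(\mathfrak{sl}_2)$ is the associative unital $\mathbb{C}$-algebra generated by $K,K^{-1},E,F$ with relations $KK^{-1}=K^{-1}K=1$, $KE=q^2EK$, $KF=q^{-2}FK$, $EF-FE=\frac{K-K^{-1}}{q-q^{-1}}$. $C(\mathfrak{p})$ is the associative unital $\mathbb{C}$-algebra generated by $c(E_0),c(F_0)$ with relations $c(E_0)^2=0$, $c(F_0)^2=0$, $c(E_0)c(F_0)+c(F_0)c(E_0)=1$ (the Clifford algebra, with respect to the trace form, of the subspace $\mathfrak{p}$ of $\mathfrak{sl}(2,\mathbb{C})$ spanned by the standard basis elements $E_0,F_0$). The tensor product is the ordinary (ungraded) tensor product of algebras. The Casimir element of $U_q(\mathfrak{sl}_2)$ is $$\mathrm{Cas}_q=2EF+\frac{2qK^{-1}+2q^{-1}K-2(q+q^{-1})}{(q-q^{-1})^2}=EF+FE+\frac{(q+q^{-1})(K+K^{-1}-2)}{(q-q^{-1})^2}.$$ $U_q(\mathfrak{k})=\mathbb{C}[K,K^{-1}]\subset U_q(\mathfrak{sl}_2)$, and $$\mathrm{Cas}_q(\mathfrak{k})=\frac{(q+q^{-1})(K+K^{-1}-2)}{(q-q^{-1})^2}\in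 U_q(\mathfrak{k}).$$ The diagonal embedding $\delta:U_q(\mathfrak{k})\to U_q(\mathfrak{sl}_2)\otimes C(\mathfrak{p})$ is the algebra homomorphism with $\delta(K)=q^{-1}K\otimes 1+(q-q^{-1})K\otimes c(E_0)c(F_0)$ and $\delta(K^{-1})=qK^{-1}\otimes 1-(q-q^{-1})K^{-1}\otimes c(E_0)c(F_0)$.
   Formalization: For q = ±i the coefficient 1/(q+q^{-1}) is undefined; the formula is stated literally when q+q^{-1} ≠ 0, and for q = ±i with the factor q+q^{-1} of Cas_q(k) cancelled, i.e. with δ((K+K^{-1}-2)/(q-q^{-1})^2) in place of that term. *)

(* Defs.v *)
From HB Require Import structures.
From mathcomp Require Import all_boot all_order all_algebra.
From mathcomp Require Import generic_quotient.
From mathcomp Require Import boolp.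
From mathcomp Require Import ring.

Set Implicit Arguments.
Unset Strict Implicit.
Unset Printing Implicit Defensive.

Import GRing.Theory Num.Theory.
Local Open Scope ring_scope.

(* Formal expressions in the generators [X] over the scalars [k]. *)
Inductive term (k X : Type) : Type :=
| tC of k
| tX of X
| tD of term k X & term k X
| tM of term k X & term k X.

Arguments tC {k X}.
Arguments tX {k X}.

Declare Scope presentation_scope.
Delimit Scope presentation_scope with pr.
Bind Scope presentation_scope with term.
Notation "s + t" := (tD s t) : presentation_scope.
Notation "s * t" := (tM s t) : presentation_scope.
Notation "c %:T" := (tC c%R) : presentation_scope.
Notation "- t" := (tM (tC (- 1)%R) t) : presentation_scope.
Notation "s - t" := (tD s (tM (tC (- 1)%R) t)) : presentation_scope.

(* The smallest congruence that contains the relations [r] and makes the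
   quotient of [term k X] a unital associative k-algebra. *)
Inductive pcong (k : fieldType) (X : Type) (r : term k X -> term k X -> Prop) :
    term k X -> term k X -> Prop :=
| pc_rel s t : r s t -> pcong r s t
| pc_refl t : pcong r t t
| pc_sym s t : pcong r s t -> pcong r t s
| pc_trans s t u : pcong r s t -> pcong r t u -> pcong r s u
| pc_D s s' t t' : pcong r s s' -> pcong r t t' -> pcong r (s + t)%pr (s' + t')%pr
| pc_M s s' t t' : pcong r s s' -> pcong r t t' -> pcong r (s * t)%pr (s' * t')%pr
| pc_addA s t u : pcong r (s + (t + u))%pr ((s + t) + u)%pr
| pc_addC s t : pcong r (s + t)%pr (t + s)%pr
| pc_add0 t : pcong r (0%:T + t)%pr t
| pc_addN t : pcong r (- t + t)%pr 0%:T%pr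
| pc_mulA s t u : pcong r (s * (t * u))%pr ((s * t) * u)%pr
| pc_mul1l t : pcong r (1%:T * t)%pr t
| pc_mul1r t : pcong r (t * 1%:T)%pr t
| pc_mulDl s t u : pcong r ((s + t) * u)%pr (s * u + t * u)%pr
| pc_mulDr s t u : pcong r (s * (t + u))%pr (s * t + s * u)%pr
| pc_CD a b : pcong r ((a + b)%R%:T)%pr (a%:T + b%:T)%pr
| pc_CM a b : pcong r ((a * b)%R%:T)%pr (a%:T * b%:T)%pr
| pc_CC a t : pcong r (a%:T * t)%pr (t * a%:T)%pr.

HB.instance Definition _ (k X : Type) := gen_eqMixin (term k X).
HB.instance Definition _ (k X : Type) := gen_choiceMixin (term k X).

Section Presentation.
Variables (k : fieldType) (X : Type) (r : term k X -> term k X -> Prop).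

Definition pcongb (s t : term k X) : bool := `[< pcong r s t >].

Lemma pcongb_refl : reflexive pcongb.
Proof. by move=> t; apply/asboolP; apply: pc_refl. Qed.

Lemma pcongb_sym : symmetric pcongb.
Proof. by move=> s t; apply/asboolP/asboolP; apply: pc_sym. Qed.

Lemma pcongb_trans : transitive pcongb.
Proof.
by move=> t s u /asboolP st /asboolP tu; apply/asboolP; apply: pc_trans tu.
Qed.

Canonical pcongb_equiv := EquivRel pcongb pcongb_refl pcongb_sym pcongb_trans.

Definition palg : Type := {eq_quot pcongb_equiv}%qT.
HB.instance Definition _ := Choice.on palg.

Definition pcl (t : term k X) : palg := \pi_({eq_quot pcongb_equiv}%qT)%qT t.
Definition prep (x : palg) : term k X := repr (x : {eq_quot pcongb_equiv}%qT).

Lemma prepK : cancel prep pcl.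
Proof. by move=> x; rewrite /pcl /prep reprK. Qed.

Lemma pclP s t : pcl s = pcl t <-> pcong r s t.
Proof.
split=> [/eqmodP/asboolP //|st]; apply/eqmodP; exact/asboolP.
Qed.

Lemma prepP t : pcong r (prep (pcl t)) t.
Proof. by apply/pclP; rewrite prepK. Qed.

Definition padd (x y : palg) : palg := pcl (prep x + prep y)%pr.
Definition pmul (x y : palg) : palg := pcl (prep x * prep y)%pr.
Definition popp (x : palg) : palg := pcl (- prep x)%pr.
Definition pscale (a : k) (x : palg) : palg := pcl (a%:T * prep x)%pr.

Lemma pcl_add s t : padd (pcl s) (pcl t) = pcl (s + t)%pr.
Proof. by apply/pclP; apply: pc_D; apply: prepP. Qed.
Lemma pcl_mul s t : pmul (pcl s) (pcl t) = pcl (s * t)%pr.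
Proof. by apply/pclP; apply: pc_M; apply: prepP. Qed.
Lemma pcl_opp t : popp (pcl t) = pcl (- t)%pr.
Proof. by apply/pclP; apply: pc_M; [apply: pc_refl|apply: prepP]. Qed.
Lemma pcl_scale a t : pscale a (pcl t) = pcl (a%:T * t)%pr.
Proof. by apply/pclP; apply: pc_M; [apply: pc_refl|apply: prepP]. Qed.

Lemma paddA : associative padd.
Proof.
move=> x y z; rewrite -(prepK x) -(prepK y) -(prepK z) !pcl_add.
by apply/pclP; apply: pc_addA.
Qed.
Lemma paddC : commutative padd.
Proof. by move=> x y; apply/pclP; apply: pc_addC. Qed.
Lemma padd0 : left_id (pcl 0%:T%pr) padd.
Proof. by move=> x; rewrite -(prepK x) pcl_add; apply/pclP; apply: pc_add0. Qed.
Lemma paddN : left_inverse (pcl 0%:T%pr) popp padd.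
Proof.
move=> x; rewrite -(prepK x) pcl_opp pcl_add.
by apply/pclP; apply: pc_addN.
Qed.
HB.instance Definition _ := GRing.isZmodule.Build palg paddA paddC padd0 paddN.

Lemma pmulA : associative pmul.
Proof.
move=> x y z; rewrite -(prepK x) -(prepK y) -(prepK z) !pcl_mul.
by apply/pclP; apply: pc_mulA.
Qed.
Lemma pmul1l : left_id (pcl 1%:T%pr) pmul.
Proof. by move=> x; rewrite -(prepK x) pcl_mul; apply/pclP; apply: pc_mul1l. Qed.
Lemma pmul1r : right_id (pcl 1%:T%pr) pmul.
Proof. by move=> x; rewrite -(prepK x) pcl_mul; apply/pclP; apply: pc_mul1r. Qed.
Lemma pmulDl : left_distributive pmul padd.
Proof.
move=> x y z; rewrite -(prepK x) -(prepK y) -(prepK z) !(pcl_mul, pcl_add).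
by apply/pclP; apply: pc_mulDl.
Qed.
Lemma pmulDr : right_distributive pmul padd.
Proof.
move=> x y z; rewrite -(prepK x) -(prepK y) -(prepK z) !(pcl_mul, pcl_add).
by apply/pclP; apply: pc_mulDr.
Qed.
HB.instance Definition _ :=
  GRing.Zmodule_isPzRing.Build palg pmulA pmul1l pmul1r pmulDl pmulDr.

Lemma pscaleA a b x : pscale a (pscale b x) = pscale (a * b) x.
Proof.
rewrite -(prepK x) !pcl_scale -!pcl_mul.
rewrite [pmul (pcl a%:T%pr) _]pmulA pcl_mul; congr pmul; apply/pclP.
by apply: pc_sym; apply: pc_CM.
Qed.
Lemma pscale1 : left_id 1 pscale.
Proof. by move=> x; rewrite -(prepK x) pcl_scale -pcl_mul pmul1l. Qed.
Lemma pscaleDr : right_distributive pscale +%R.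
Proof.
move=> a x y; rewrite -(prepK x) -(prepK y) /+%R /= pcl_add !pcl_scale pcl_add.
by apply/pclP; apply: pc_mulDr.
Qed.
Lemma pscaleDl x : {morph pscale^~ x : a b / a + b}.
Proof.
move=> a b; rewrite -(prepK x) [RHS]/+%R /= !pcl_scale pcl_add.
apply/pclP; apply: pc_trans (pc_mulDl _ _ _ _).
by apply: pc_M; [apply: pc_CD|apply: pc_refl].
Qed.
HB.instance Definition _ :=
  GRing.Zmodule_isLmodule.Build k palg pscaleA pscale1 pscaleDr pscaleDl.

Lemma palg_scalerAl a (x y : palg) : a *: (x * y) = a *: x * y.
Proof.
rewrite /*:%R/= /*%R/= -(prepK x) -(prepK y) !(pcl_mul, pcl_scale).
by apply/pclP; apply: pc_mulA.
Qed.

Lemma palg_scalerAr a (x y : palg) : a *: (x * y) = x * (a *: y).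
Proof.
rewrite /*:%R/= /*%R/= -(prepK x) -(prepK y) !(pcl_mul, pcl_scale).
apply/pclP; apply: pc_trans (pc_mulA _ _ _ _) _.
apply: pc_trans (pc_sym (pc_mulA _ _ _ _)).
by apply: pc_M; [apply: pc_CC|apply: pc_refl].
Qed.

End Presentation.

(* The universal property of the presentation. *)
Section PresentationEval.
Variables (k : fieldType) (X : Type) (r : term k X -> term k X -> Prop).
Variables (B : algType k) (f : X -> B).

Fixpoint teval (t : term k X) : B :=
  match t with
  | tC c => c%:A
  | tX x => f x
  | tD s t => teval s + teval t
  | tM s t => teval s * teval t
  end.

Hypothesis fr : forall s t, r s t -> teval s = teval t.

Lemma teval_pcong s t : pcong r s t -> teval s = teval t.
Proof.
elim=> {s t} //=.
- by move=> s t u _ -> _ ->.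
- by move=> s s' t t' _ -> _ ->.
- by move=> s s' t t' _ -> _ ->.
- by move=> *; rewrite addrA.
- by move=> *; rewrite addrC.
- by move=> *; rewrite scale0r add0r.
- by move=> *; rewrite mulr_algl scaleN1r scale0r addNr.
- by move=> *; rewrite mulrA.
- by move=> *; rewrite scale1r mul1r.
- by move=> *; rewrite scale1r mulr1.
- by move=> *; rewrite mulrDl.
- by move=> *; rewrite mulrDr.
- by move=> *; rewrite scalerDl.
- by move=> *; rewrite mulr_algl scalerA.
- by move=> *; rewrite mulr_algl mulr_algr.
Qed.

Definition peval (x : palg r) : B := teval (prep x).

Lemma peval_pcl t : peval (pcl r t) = teval t.
Proof. by apply: teval_pcong; apply: prepP. Qed.

End PresentationEval.

(* A formal sum [:: (a1, b1); ...; (an, bn)] stands for a1 ⊗ b1 + ... + an ⊗ bn;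
   [tcong] is the smallest congruence making (a, b) |-> a ⊗ b bilinear. *)
Inductive tcong (k : fieldType) (A B : lmodType k) :
    seq (A * B) -> seq (A * B) -> Prop :=
| tc_refl s : tcong s s
| tc_sym s t : tcong s t -> tcong t s
| tc_trans s t u : tcong s t -> tcong t u -> tcong s u
| tc_cat s s' t t' : tcong s s' -> tcong t t' -> tcong (s ++ t) (s' ++ t')
| tc_catC s t : tcong (s ++ t) (t ++ s)
| tc_0 b : tcong [:: (0, b)] [::]
| tc_Dl a a' b : tcong [:: (a + a', b)] [:: (a, b); (a', b)]
| tc_Dr a b b' : tcong [:: (a, b + b')] [:: (a, b); (a, b')]
| tc_Z c a b : tcong [:: (c *: a, b)] [:: (a, c *: b)].

Section TensorModule.
Variables (k : fieldType) (A B : lmodType k).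

Definition tcongb (s t : seq (A * B)) : bool := `[< tcong s t >].

Lemma tcongb_refl : reflexive tcongb.
Proof. by move=> t; apply/asboolP; apply: tc_refl. Qed.

Lemma tcongb_sym : symmetric tcongb.
Proof. by move=> s t; apply/asboolP/asboolP; apply: tc_sym. Qed.

Lemma tcongb_trans : transitive tcongb.
Proof.
by move=> t s u /asboolP st /asboolP tu; apply/asboolP; apply: tc_trans tu.
Qed.

Canonical tcongb_equiv := EquivRel tcongb tcongb_refl tcongb_sym tcongb_trans.

Definition tensor : Type := {eq_quot tcongb_equiv}%qT.
HB.instance Definition _ := Choice.on tensor.

Definition tcl (s : seq (A * B)) : tensor := \pi_({eq_quot tcongb_equiv}%qT)%qT s.
Definition trep (x : tensor) : seq (A * B) := repr (x : {eq_quot tcongb_equiv}%qT).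

Lemma trepK : cancel trep tcl.
Proof. by move=> x; rewrite /tcl /trep reprK. Qed.

Lemma tclP s t : tcl s = tcl t <-> tcong s t.
Proof.
split=> [/eqmodP/asboolP //|st]; apply/eqmodP; exact/asboolP.
Qed.

Lemma trepP t : tcong (trep (tcl t)) t.
Proof. by apply/tclP; rewrite trepK. Qed.

Definition tens (a : A) (b : B) : tensor := tcl [:: (a, b)].

Definition sscale (c : k) (s : seq (A * B)) := [seq (c *: x.1, x.2) | x <- s].

Lemma sscale_tcong c s t : tcong s t -> tcong (sscale c s) (sscale c t).
Proof.
elim=> {s t} /=.
- by move=> *; apply: tc_refl.
- by move=> s t _; apply: tc_sym.
- by move=> s t u _ IH _; apply: tc_trans.
- by move=> s s' t t' _ IH _; rewrite /sscale !map_cat; apply: tc_cat.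
- by move=> s t; rewrite /sscale !map_cat; apply: tc_catC.
- by move=> b; rewrite scaler0; apply: tc_0.
- by move=> a a' b; rewrite scalerDr; apply: tc_Dl.
- by move=> a a' b; apply: tc_Dr.
- by move=> d a b; rewrite scalerA mulrC -scalerA; apply: tc_Z.
Qed.

Lemma tc_cat4 (s s' t t' : seq (A * B)) : tcong ((s ++ s') ++ (t ++ t')) ((s ++ t) ++ (s' ++ t')).
Proof.
rewrite -!catA; apply: tc_cat; first exact: tc_refl.
rewrite !catA; apply: tc_cat; last exact: tc_refl; exact: tc_catC.
Qed.

Definition tadd (x y : tensor) : tensor := tcl (trep x ++ trep y).
Definition tscale (c : k) (x : tensor) : tensor := tcl (sscale c (trep x)).
Definition topp (x : tensor) : tensor := tscale (-1) x.

Lemma tcl_add s t : tadd (tcl s) (tcl t) = tcl (s ++ t).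
Proof. by apply/tclP; apply: tc_cat; apply: trepP. Qed.
Lemma tcl_scale c s : tscale c (tcl s) = tcl (sscale c s).
Proof. by apply/tclP; apply: sscale_tcong; apply: trepP. Qed.

Lemma taddA : associative tadd.
Proof.
by move=> x y z; rewrite -(trepK x) -(trepK y) -(trepK z) !tcl_add catA.
Qed.
Lemma taddC : commutative tadd.
Proof. by move=> x y; apply/tclP; apply: tc_catC. Qed.
Lemma tadd0 : left_id (tcl [::]) tadd.
Proof. by move=> x; rewrite -(trepK x) tcl_add. Qed.

Lemma sscaleDl c d s : tcong (sscale (c + d) s) (sscale c s ++ sscale d s).
Proof.
elim: s => [|[a b] s IH] /=; first exact: tc_refl.
apply: tc_trans (tc_cat (s := [:: _]) (tc_refl _) IH) _.
rewrite scalerDl; apply: tc_trans (tc_cat (tc_Dl _ _ _) (tc_refl _)) _ => /=.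
exact: (tc_cat4 [:: (c *: a, b)] [:: (d *: a, b)]).
Qed.

Lemma sscale0 s : tcong (sscale 0 s) [::].
Proof.
elim: s => [|[a b] s IH] /=; first exact: tc_refl.
rewrite scale0r -cat1s; apply: (tc_cat (s' := [::])) IH.
exact: tc_0.
Qed.

Lemma tscaleA c d x : tscale c (tscale d x) = tscale (c * d) x.
Proof.
rewrite -(trepK x) !tcl_scale /sscale -map_comp; congr tcl.
by apply: eq_map => y /=; rewrite scalerA.
Qed.
Lemma tscale1 : left_id 1 tscale.
Proof.
move=> x; rewrite -[RHS]trepK -[in LHS](trepK x) tcl_scale; congr tcl.
by rewrite -[RHS]map_id; apply: eq_map => -[a b] /=; rewrite scale1r.
Qed.
Lemma tscaleDr : right_distributive tscale tadd.
Proof.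
move=> c x y; rewrite -(trepK x) -(trepK y) !(tcl_scale, tcl_add).
by rewrite /sscale map_cat.
Qed.
Lemma tscaleDl x c d : tscale (c + d) x = tadd (tscale c x) (tscale d x).
Proof.
rewrite -(trepK x) !(tcl_scale, tcl_add); apply/tclP; exact: sscaleDl.
Qed.
Lemma tscale0 x : tscale 0 x = tcl [::].
Proof. by rewrite -(trepK x) tcl_scale; apply/tclP; exact: sscale0. Qed.
Lemma taddN : left_inverse (tcl [::]) topp tadd.
Proof.
by move=> x; rewrite -{2}[x]tscale1 /topp -tscaleDl addNr tscale0.
Qed.

HB.instance Definition _ := GRing.isZmodule.Build tensor taddA taddC tadd0 taddN.
HB.instance Definition _ :=
  GRing.Zmodule_isLmodule.Build k tensor tscaleA tscale1 tscaleDr tscaleDl.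

End TensorModule.

Section TensorAlgebra.
Variables (k : fieldType) (A B : algType k).
Implicit Types s t u : seq (A * B).

Definition smul s t := [seq (x.1 * y.1, x.2 * y.2) | x <- s, y <- t].

Lemma smul0s t : smul [::] t = [::]. Proof. by []. Qed.
Lemma smulDl s t u : smul (s ++ t) u = smul s u ++ smul t u.
Proof. exact: allpairs_cat. Qed.
Lemma smulss x s t : smul (x :: s) t = smul [:: x] t ++ smul s t.
Proof. by rewrite -cat1s smulDl. Qed.

Lemma smul1D x t u : smul [:: x] (t ++ u) = smul [:: x] t ++ smul [:: x] u.
Proof. by rewrite /smul /= !cats0 map_cat. Qed.

Lemma smulDr s t u : tcong (smul s (t ++ u)) (smul s t ++ smul s u).
Proof.
elim: s => [|x s IH]; first exact: tc_refl.
rewrite !(smulss x s); apply: tc_trans (tc_cat (tc_refl _) IH) _.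
by rewrite smul1D; apply: tc_cat4.
Qed.

Lemma smuls0 s : smul s [::] = [::].
Proof. by elim: s. Qed.

Lemma smul1s x y t : smul [:: x] (y :: t) = (x.1 * y.1, x.2 * y.2) :: smul [:: x] t.
Proof. by []. Qed.

Lemma smul_tcongl s s' t : tcong s s' -> tcong (smul s t) (smul s' t).
Proof.
elim=> {s s'}.
- by move=> s; apply: tc_refl.
- by move=> s s' _; apply: tc_sym.
- by move=> s s' s'' _ IH _; apply: tc_trans.
- by move=> s s' u u' _ IH _; rewrite !smulDl; apply: tc_cat.
- by move=> s s'; rewrite !smulDl; apply: tc_catC.
- move=> b; elim: t => [|y t IH]; first exact: tc_refl.
  rewrite smul1s /= mul0r -cat1s; apply: (tc_cat (s' := [::])) IH.
  exact: tc_0.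
- move=> a a' b; rewrite [smul [:: (a, b); _] _]smulss.
  elim: t => [|y t IH]; first exact: tc_refl.
  rewrite !smul1s -cat1s -(cat1s _ (smul [:: (a, b)] t)).
  rewrite -(cat1s _ (smul [:: (a', b)] t)).
  apply: tc_trans (tc_cat (tc_refl _) IH) _.
  apply: tc_trans (tc_cat4 _ _ _ _).
  apply: tc_cat; last exact: tc_refl.
  by rewrite /= mulrDl; apply: tc_Dl.
- move=> a b b'; rewrite [smul [:: (a, b); _] _]smulss.
  elim: t => [|y t IH]; first exact: tc_refl.
  rewrite !smul1s -cat1s -(cat1s _ (smul [:: (a, b)] t)).
  rewrite -(cat1s _ (smul [:: (a, b')] t)).
  apply: tc_trans (tc_cat (tc_refl _) IH) _.
  apply: tc_trans (tc_cat4 _ _ _ _).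
  apply: tc_cat; last exact: tc_refl.
  by rewrite /= mulrDl; apply: tc_Dr.
- move=> c a b; elim: t => [|y t IH]; first exact: tc_refl.
  rewrite !smul1s -cat1s -[X in tcong _ X]cat1s; apply: tc_cat IH => /=.
  by rewrite -!scalerAl; apply: tc_Z.
Qed.

Lemma smul_tcongr s t t' : tcong t t' -> tcong (smul s t) (smul s t').
Proof.
elim=> {t t'}.
- by move=> t; apply: tc_refl.
- by move=> t t' _; apply: tc_sym.
- by move=> t t' t'' _ IH _; apply: tc_trans.
- move=> t t' u u' _ IHt _ IHu.
  apply: tc_trans (smulDr _ _ _) _; apply: tc_trans (tc_sym (smulDr _ _ _)).
  exact: tc_cat.
- move=> t u; apply: tc_trans (smulDr _ _ _) _.
  by apply: tc_trans (tc_sym (smulDr _ _ _)); apply: tc_catC.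
- move=> b; elim: s => [|x s IH]; first exact: tc_refl.
  rewrite smulss smuls0 smul1s /= mulr0 -cat1s; apply: (tc_cat (s' := [::])).
    exact: tc_0.
  by rewrite smuls0 in IH.
- move=> a a' b; elim: s => [|x s IH]; first exact: tc_refl.
  rewrite !(smulss x s); apply: tc_cat IH.
  by rewrite /smul /= mulrDr; apply: tc_Dl.
- move=> a b b'; elim: s => [|x s IH]; first exact: tc_refl.
  rewrite !(smulss x s); apply: tc_cat IH.
  by rewrite /smul /= mulrDr; apply: tc_Dr.
- move=> c a b; elim: s => [|x s IH]; first exact: tc_refl.
  rewrite !(smulss x s); apply: tc_cat IH.
  by rewrite /smul /= -!scalerAr; apply: tc_Z.
Qed.

Local Notation T := (tensor A B).

Definition tmul (x y : T) : T := tcl (smul (trep x) (trep y)).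

Lemma tcl_mul s t : tmul (tcl s) (tcl t) = tcl (smul s t).
Proof.
apply/tclP; apply: tc_trans (smul_tcongl _ (trepP s)) _.
exact: smul_tcongr (trepP t).
Qed.

Lemma smulA s t u : smul s (smul t u) = smul (smul s t) u.
Proof.
elim: s => [//|x s IH]; rewrite smulss (smulss x s t) smulDl IH; congr cat.
elim: t {IH} => [//|y t IH].
rewrite [smul (y :: t) u]smulss smul1D IH smul1s [RHS]smulss; congr cat.
by rewrite /smul /= !cats0 -map_comp; apply: eq_map => z /=; rewrite !mulrA.
Qed.

Lemma tmulA : associative tmul.
Proof.
by move=> x y z; rewrite -(trepK x) -(trepK y) -(trepK z) !tcl_mul smulA.
Qed.

Lemma tmul1l : left_id (tens 1 1) tmul.
Proof.
move=> x; rewrite -[RHS]trepK -[in LHS](trepK x) tcl_mul /smul /= cats0.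
by congr tcl; rewrite -[RHS]map_id; apply: eq_map => -[a b] /=; rewrite !mul1r.
Qed.

Lemma tmul1r : right_id (tens 1 1) tmul.
Proof.
move=> x; rewrite -[RHS]trepK -[in LHS](trepK x) tcl_mul; congr tcl.
elim: (trep x) => [//|[a b] s IH]; rewrite smulss IH.
by rewrite /smul /= !mulr1.
Qed.

Lemma tmulDl : left_distributive tmul +%R.
Proof.
move=> x y z; rewrite -(trepK x) -(trepK y) -(trepK z) /+%R /=.
by rewrite !(tcl_mul, tcl_add) smulDl.
Qed.

Lemma tmulDr : right_distributive tmul +%R.
Proof.
move=> x y z; rewrite -(trepK x) -(trepK y) -(trepK z) /+%R /=.
by rewrite !(tcl_mul, tcl_add); apply/tclP; exact: smulDr.
Qed.

HB.instance Definition _ :=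
  GRing.Zmodule_isPzRing.Build T tmulA tmul1l tmul1r tmulDl tmulDr.

Lemma tensor_scalerAl c (x y : T) : c *: (x * y) = c *: x * y.
Proof.
rewrite /*:%R/= /*%R/= -(trepK x) -(trepK y) !(tcl_mul, tcl_scale).
congr tcl; elim: (trep x) => [//|z s IH].
rewrite smulss /= [RHS]smulss -IH /sscale map_cat; congr cat.
rewrite /smul /= !cats0 -map_comp; apply: eq_map => w /=.
by rewrite scalerAl.
Qed.

Lemma tensor_scalerAr c (x y : T) : c *: (x * y) = x * (c *: y).
Proof.
rewrite /*:%R/= /*%R/= -(trepK x) -(trepK y) !(tcl_mul, tcl_scale).
congr tcl; elim: (trep x) => [//|z s IH].
rewrite smulss [RHS]smulss -IH /sscale map_cat; congr cat.
rewrite /smul /= !cats0 -!map_comp; apply: eq_map => w /=.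
by rewrite scalerAr.
Qed.

Lemma tens_mul a b a' b' : tens a b * tens a' b' = tens (a * a') (b * b') :> T.
Proof. exact: tcl_mul. Qed.

End TensorAlgebra.

Section TensorForm.
Variables (k : fieldType) (A B : lmodType k).
Variables (phi : A -> k) (psi : B -> k).
Hypothesis phi_lin : forall c a a', phi (c *: a + a') = c * phi a + phi a'.
Hypothesis psi_lin : forall c a a', psi (c *: a + a') = c * psi a + psi a'.

Definition tform (x : tensor A B) : k := \sum_(y <- trep x) phi y.1 * psi y.2.

Lemma tform_tcl s : tform (tcl s) = \sum_(y <- s) phi y.1 * psi y.2.
Proof.
have phi0 : phi 0 = 0.
  by have := phi_lin (-1) 0 0; rewrite scaler0 add0r mulN1r addNr.
have psi0 : psi 0 = 0.
  by have := psi_lin (-1) 0 0; rewrite scaler0 add0r mulN1r addNr.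
suff H s1 s2 : tcong s1 s2 ->
    \sum_(y <- s1) phi y.1 * psi y.2 = \sum_(y <- s2) phi y.1 * psi y.2.
  exact: H (trepP s).
elim=> {s s1 s2} //.
- by move=> s t u _ -> _ ->.
- by move=> s s' t t' _ IH1 _ IH2; rewrite !big_cat IH1 IH2.
- by move=> s t; rewrite !big_cat /= addrC.
- by move=> b; rewrite big_seq1 big_nil /= phi0 mul0r.
- move=> a a' b; rewrite !big_cons !big_nil /= !addr0.
  by rewrite -{1}[a]scale1r phi_lin mul1r mulrDl.
- move=> a b b'; rewrite !big_cons !big_nil /= !addr0.
  by rewrite -{1}[b]scale1r psi_lin mul1r mulrDr.
- move=> c a b; rewrite !big_seq1 /=.
  rewrite -[c *: a]addr0 -[c *: b]addr0 phi_lin psi_lin phi0 psi0 !addr0.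
  by rewrite mulrCA mulrA.
Qed.

End TensorForm.

Notation "a ⊗ b" := (tens a b) (at level 40, left associativity) : ring_scope.

Inductive uq_gen := gen_K | gen_Kinv | gen_E | gen_F.

Inductive uq_rel (k : fieldType) (q : k) :
    term k uq_gen -> term k uq_gen -> Prop :=
| uq_KKinv : uq_rel q (tX gen_K * tX gen_Kinv)%pr 1%:T%pr
| uq_KinvK : uq_rel q (tX gen_Kinv * tX gen_K)%pr 1%:T%pr
| uq_KE : uq_rel q (tX gen_K * tX gen_E)%pr
                   ((q ^+ 2)%R%:T * (tX gen_E * tX gen_K))%pr
| uq_KF : uq_rel q (tX gen_K * tX gen_F)%pr
                   ((q ^- 2)%R%:T * (tX gen_F * tX gen_K))%pr
| uq_EF : uq_rel q (tX gen_E * tX gen_F - tX gen_F * tX gen_E)%pr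
                   (((q - q^-1)^-1)%R%:T * (tX gen_K - tX gen_Kinv))%pr.

Definition Uq (k : fieldType) (q : k) : Type := palg (uq_rel q).

(* [gen_e] and [gen_f] stand for c(E_0) and c(F_0). *)
Inductive cl_gen := gen_e | gen_f.

Inductive cl_rel (k : fieldType) : term k cl_gen -> term k cl_gen -> Prop :=
| cl_ee : cl_rel (tX gen_e * tX gen_e)%pr 0%:T%pr
| cl_ff : cl_rel (tX gen_f * tX gen_f)%pr 0%:T%pr
| cl_ef : cl_rel (tX gen_e * tX gen_f + tX gen_f * tX gen_e)%pr 1%:T%pr.

Definition Clp (k : fieldType) : Type := palg (@cl_rel k).

Section Instances.
Variables (k : fieldType) (q : k).

HB.instance Definition _ := GRing.Lmodule.copy (Uq q) (palg (uq_rel q)).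
HB.instance Definition _ := GRing.PzRing.copy (Uq q) (palg (uq_rel q)).
HB.instance Definition _ := GRing.Lmodule.copy (Clp k) (palg (@cl_rel k)).
HB.instance Definition _ := GRing.PzRing.copy (Clp k) (palg (@cl_rel k)).

(* The counit of [Uq q] and the spin representation of [Clp k] only serve to
   prove 1 != 0, which MathComp's [algType] requires. *)
Definition counit_gen (x : uq_gen) : k^o :=
  match x with gen_K | gen_Kinv => 1 | gen_E | gen_F => 0 end.

Lemma counit_rel s t : uq_rel q s t -> teval counit_gen s = teval counit_gen t.
Proof.
by case; rewrite /= ?(mulr1, mulr0, mul0r, scale1r, addr0, subr0, scaleN1r, subrr).
Qed.

Definition counit : Uq q -> k := peval (r := uq_rel q) counit_gen.

Lemma counit_lin c (x y : Uq q) : counit (c *: x + y) = c * counit x + counit y.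
Proof.
rewrite -(prepK x) -(prepK y) /counit.
rewrite {1}/*:%R {1}/+%R /= pcl_scale pcl_add !(peval_pcl counit_rel) /=.
by rewrite mulr_algl.
Qed.

Lemma counit1 : counit 1 = 1.
Proof. by rewrite /counit /= (peval_pcl counit_rel) /= scale1r. Qed.

Lemma Uq_oner_neq0 : (1 : Uq q) != 0.
Proof.
apply/eqP => /(congr1 counit); rewrite counit1 /counit.
rewrite {1}/GRing.zero /= (peval_pcl counit_rel) /= scale0r.
exact/eqP/oner_neq0.
Qed.

HB.instance Definition _ := GRing.PzSemiRing_isNonZero.Build (Uq q) Uq_oner_neq0.
HB.instance Definition _ :=
  GRing.Lmodule_isLalgebra.Build k (Uq q) (@palg_scalerAl _ _ (uq_rel q)).
HB.instance Definition _ :=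
  GRing.Lalgebra_isAlgebra.Build k (Uq q) (@palg_scalerAr _ _ (uq_rel q)).

Definition spin_gen (x : cl_gen) : 'M[k]_2 :=
  match x with gen_e => delta_mx ord0 ord_max | gen_f => delta_mx ord_max ord0 end.

Lemma spin_rel s t : @cl_rel k s t -> teval spin_gen s = teval spin_gen t.
Proof.
case=> /=; rewrite ?(scale0r, scale1r) -?mulmxE.
- by rewrite mul_delta_mx_0.
- by rewrite mul_delta_mx_0.
- rewrite !mul_delta_mx; apply/matrixP => i j; rewrite !mxE.
  by case: i j => -[|[|//]] ? [] [|[|//]] ?; rewrite /= ?(addr0, add0r).
Qed.

Definition spin : Clp k -> 'M[k]_2 := peval (r := @cl_rel k) spin_gen.

Definition spin_form (x : Clp k) : k := spin x ord0 ord0.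

Lemma spin_form_lin c (x y : Clp k) :
  spin_form (c *: x + y) = c * spin_form x + spin_form y.
Proof.
rewrite -(prepK x) -(prepK y) /spin_form /spin.
rewrite {1}/*:%R {1}/+%R /= pcl_scale pcl_add !(peval_pcl spin_rel) /=.
by rewrite mulr_algl !mxE.
Qed.

Lemma spin_form1 : spin_form 1 = 1.
Proof. by rewrite /spin_form /spin /= (peval_pcl spin_rel) /= scale1r mxE. Qed.

Lemma Clp_oner_neq0 : (1 : Clp k) != 0.
Proof.
apply/eqP => /(congr1 spin_form); rewrite spin_form1 /spin_form /spin.
rewrite {1}/GRing.zero /= (peval_pcl spin_rel) /= scale0r mxE.
exact/eqP/oner_neq0.
Qed.

HB.instance Definition _ := GRing.PzSemiRing_isNonZero.Build (Clp k) Clp_oner_neq0.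
HB.instance Definition _ :=
  GRing.Lmodule_isLalgebra.Build k (Clp k) (@palg_scalerAl _ _ (@cl_rel k)).
HB.instance Definition _ :=
  GRing.Lalgebra_isAlgebra.Build k (Clp k) (@palg_scalerAr _ _ (@cl_rel k)).

Local Notation UqClp := (tensor (Uq q) (Clp k)).

Lemma UqClp_oner_neq0 : (1 : UqClp) != 0.
Proof.
have H := tform_tcl counit_lin spin_form_lin.
apply/eqP => /(congr1 (tform counit spin_form)).
rewrite {1}/GRing.one {1}/GRing.zero /= !H big_seq1 big_nil /=.
rewrite counit1 spin_form1 mulr1; exact/eqP/oner_neq0.
Qed.

HB.instance Definition _ := GRing.PzSemiRing_isNonZero.Build UqClp UqClp_oner_neq0.
HB.instance Definition _ :=
  GRing.Lmodule_isLalgebra.Build k UqClp (@tensor_scalerAl _ (Uq q) (Clp k)).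
HB.instance Definition _ :=
  GRing.Lalgebra_isAlgebra.Build k UqClp (@tensor_scalerAr _ (Uq q) (Clp k)).

Definition uK : Uq q := pcl (uq_rel q) (tX gen_K).
Definition uKinv : Uq q := pcl (uq_rel q) (tX gen_Kinv).
Definition uE : Uq q := pcl (uq_rel q) (tX gen_E).
Definition uF : Uq q := pcl (uq_rel q) (tX gen_F).

Definition cE0 : Clp k := pcl (@cl_rel k) (tX gen_e).
Definition cF0 : Clp k := pcl (@cl_rel k) (tX gen_f).

Lemma pcl_rel s t : uq_rel q s t -> pcl (uq_rel q) s = pcl (uq_rel q) t.
Proof. by move=> st; apply/pclP/pc_rel. Qed.

Lemma uKKinv : uK * uKinv = 1.
Proof. by rewrite /uK /uKinv [LHS]pcl_mul (pcl_rel (uq_KKinv q)). Qed.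

Lemma uKinvK : uKinv * uK = 1.
Proof. by rewrite /uK /uKinv [LHS]pcl_mul (pcl_rel (uq_KinvK q)). Qed.

End Instances.

Lemma horner_algMXaddC (k : fieldType) (B : algType k) (x : B) p c :
  horner_alg x (p * 'X + c%:P) = horner_alg x p * x + c%:A.
Proof. by rewrite rmorphD rmorphM /= horner_algX horner_algC. Qed.

Section Laurent.
Variables (k : fieldType) (B : algType k).

(* p(x) y^m, with y the inverse of x *)
Definition laurent (x y : B) (p : {poly k}) (m : nat) : B :=
  horner_alg x p * y ^+ m.

Variables x y : B.
Hypotheses (xy : x * y = 1) (yx : y * x = 1).

Lemma laurent_comm p m : horner_alg x p * y ^+ m = y ^+ m * horner_alg x p.
Proof.
have xyC : GRing.comm (y ^+ m) x.
  by apply/commr_sym/commrX; rewrite /GRing.comm xy yx.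
elim/poly_ind: p => [|p c IH]; first by rewrite !raddf0 mul0r mulr0.
rewrite horner_algMXaddC mulrDl mulrDr.
by rewrite -mulrA -xyC mulrA IH -mulrA mulr_algl mulr_algr.
Qed.

Lemma laurent_expXY n : x ^+ n * y ^+ n = 1.
Proof. by rewrite -exprMn_comm ?xy ?expr1n // /GRing.comm xy yx. Qed.

Lemma laurent_shift p m n : laurent x y p m = laurent x y (p * 'X^n) (m + n).
Proof.
rewrite /laurent rmorphM rmorphXn /= horner_algX addnC exprD -mulrA.
by rewrite (mulrA (x ^+ n)) laurent_expXY mul1r.
Qed.

Lemma laurentD p m r n :
  laurent x y p m + laurent x y r n = laurent x y (p * 'X^n + r * 'X^m) (m + n).
Proof.
rewrite (laurent_shift p m n) (laurent_shift r n m) (addnC n m).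
by rewrite -mulrDl -raddfD.
Qed.

Lemma laurentM p m r n :
  laurent x y p m * laurent x y r n = laurent x y (p * r) (m + n).
Proof.
rewrite /laurent rmorphM exprD /= -!mulrA; congr (_ * _).
by rewrite mulrA -laurent_comm -mulrA.
Qed.

Lemma laurentZ c p m : c *: laurent x y p m = laurent x y (c *: p) m.
Proof.
by rewrite /laurent -mul_polyC rmorphM /= horner_algC mulr_algl scalerAl.
Qed.

Lemma laurent1 : laurent x y 1 0 = 1.
Proof. by rewrite /laurent rmorph1 mulr1. Qed.

Lemma laurentX : laurent x y 'X 0 = x.
Proof. by rewrite /laurent horner_algX mulr1. Qed.

Lemma laurentY : laurent x y 1 1 = y.
Proof. by rewrite /laurent rmorph1 mul1r. Qed.

Lemma laurent_cross p m r n : laurent x y p m = laurent x y r n ->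
  horner_alg x (p * 'X^n) = horner_alg x (r * 'X^m).
Proof.
rewrite (laurent_shift p m n) (laurent_shift r n m) (addnC n m) /laurent.
move=> /(congr1 (fun z => z * x ^+ (m + n))); rewrite -!mulrA.
have -> : y ^+ (m + n) * x ^+ (m + n) = 1.
  by rewrite -exprMn_comm ?yx ?expr1n // /GRing.comm xy yx.
by rewrite !mulr1.
Qed.

End Laurent.

Section Uqk.
Variables (k : fieldType) (q : k).

(* U_q(k) = C[K, K^-1]: every Laurent polynomial in K is p(K) K^-m. *)
Definition uqk_pred : pred (Uq q) :=
  fun x => `[< exists p m, x = laurent (uK q) (uKinv q) p m >].

Lemma uqk_subalg_closed : subalg_closed uqk_pred.
Proof.
have KKi := uKKinv q; have KiK := uKinvK q.
split=> [|c u v|u v].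
- by apply/asboolP; exists 1, 0%N; rewrite laurent1.
- move=> /asboolP[p [m ->]] /asboolP[r [n ->]]; apply/asboolP.
  by rewrite laurentZ laurentD //; do 2!eexists.
- move=> /asboolP[p [m ->]] /asboolP[r [n ->]]; apply/asboolP.
  by rewrite laurentM //; do 2!eexists.
Qed.

HB.instance Definition _ :=
  GRing.isSubalgClosed.Build k (Uq q) uqk_pred uqk_subalg_closed.

Record Uqk : Type := MkUqk { uqk_val : Uq q; _ : uqk_val \in uqk_pred }.

HB.instance Definition _ := [isSub for uqk_val].
HB.instance Definition _ := [Choice of Uqk by <:].
HB.instance Definition _ := [SubChoice_isSubAlgebra of Uqk by <:].

Lemma uqk_valP (u : Uqk) : exists p m, val u = laurent (uK q) (uKinv q) p m.
Proof. exact/asboolP/(valP u). Qed.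

Lemma uK_in : uK q \in uqk_pred.
Proof. by apply/asboolP; exists 'X, 0%N; rewrite laurentX. Qed.

Lemma uKinv_in : uKinv q \in uqk_pred.
Proof. by apply/asboolP; exists 1, 1%N; rewrite laurentY. Qed.

Definition kK : Uqk := MkUqk uK_in.
Definition kKinv : Uqk := MkUqk uKinv_in.

End Uqk.

(* Verma modules show that the powers of K are linearly independent, so that
   the diagonal embedding is well defined. *)
Section Verma.
Variables (k : numFieldType) (q : k).
Hypothesis q0 : q != 0.
Variable lam : k.
Hypothesis lam0 : lam != 0.

Definition verma_wt (n : nat) : k := lam * q ^- (2 * n).
Definition verma_coef (n : nat) : k :=
  \sum_(i < n) (q - q^-1)^-1 * (verma_wt i - (verma_wt i)^-1).

Fixpoint verma (t : term k uq_gen) (f : nat -> k) : nat -> k :=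
  match t with
  | tC c => fun n => c * f n
  | tX gen_K => fun n => verma_wt n * f n
  | tX gen_Kinv => fun n => (verma_wt n)^-1 * f n
  | tX gen_E => fun n => verma_coef n.+1 * f n.+1
  | tX gen_F => fun n => if n is n'.+1 then f n' else 0
  | tD s t => fun n => verma s f n + verma t f n
  | tM s t => verma s (verma t f)
  end.

Lemma verma_wt_neq0 n : verma_wt n != 0.
Proof. by rewrite mulf_neq0 // invr_neq0 // expf_neq0. Qed.

Lemma verma_wtS n : verma_wt n = q ^+ 2 * verma_wt n.+1.
Proof.
rewrite /verma_wt mulnS exprD mulrCA; congr (_ * _).
by rewrite invfM mulrA divff ?mul1r // expf_neq0.
Qed.

Lemma verma_lin t c f g :
  verma t (fun n => c * f n + g n) = (fun n => c * verma t f n + verma t g n).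
Proof.
elim: t f g => [d|[]|s IHs t IHt|s IHs t IHt] f g; apply/funext => n /=.
- by rewrite mulrDr mulrCA.
- by rewrite mulrDr mulrCA.
- by rewrite mulrDr mulrCA.
- by rewrite mulrDr mulrCA.
- by case: n => [|n] //; rewrite mulr0 addr0.
- by rewrite IHs IHt mulrDr addrACA.
- by rewrite IHt IHs.
Qed.

Lemma vermaD t f g :
  verma t (fun n => f n + g n) = (fun n => verma t f n + verma t g n).
Proof.
transitivity (verma t (fun n => 1 * f n + g n)).
  by congr verma; apply/funext => n; rewrite mul1r.
by rewrite verma_lin; apply/funext => n; rewrite mul1r.
Qed.

Lemma vermaZ t c f : verma t (fun n => c * f n) = (fun n => c * verma t f n).
Proof.
have v0 : verma t (fun=> 0) = (fun=> 0).
  apply/funext => n; have := vermaD t (fun=> 0) (fun=> 0).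
  move=> /(congr1 (fun f => f n)) /=.
  have -> : (fun _ : nat => 0 + 0 :> k) = (fun=> 0).
    by apply/funext => ?; rewrite addr0.
  by move=> /eqP; rewrite -subr_eq0 opprD addrA subrr sub0r oppr_eq0 => /eqP.
transitivity (verma t (fun n => c * f n + (fun=> 0) n)).
  by congr verma; apply/funext => n; rewrite addr0.
by rewrite verma_lin v0; apply/funext => n; rewrite addr0.
Qed.

Lemma verma_rel s t : uq_rel q s t -> verma s = verma t.
Proof.
move=> st; apply/funext => f; apply/funext => n.
case: st => /=.
- by rewrite mulrA divff ?verma_wt_neq0.
- by rewrite mulrA mulVf ?verma_wt_neq0.
- by rewrite [verma_wt n]verma_wtS -[LHS]mulrA; congr (_ * _); apply: mulrCA.
- case: n => [|n] /=; first by rewrite !mulr0.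
  by rewrite [verma_wt n]verma_wtS -[q ^+ 2 * _ * _]mulrA mulKf // expf_neq0.
- rewrite [-1 * (_^-1 * _)]mulN1r -mulrBl mulrA.
  case: n => [|n] /=.
    by rewrite mulr0 addr0 /verma_coef big_ord_recl big_ord0 addr0.
  rewrite mulN1r -mulrBl; congr (_ * _).
  have -> : verma_coef n.+2 = verma_coef n.+1 +
    (q - q^-1)^-1 * (verma_wt n.+1 - (verma_wt n.+1)^-1) by exact: big_ord_recr.
  by rewrite [LHS]addrAC subrr add0r.
Qed.

Lemma verma_pcong s t : pcong (uq_rel q) s t -> verma s = verma t.
Proof.
elim=> {s t} //=.
- exact: verma_rel.
- by move=> s t u _ -> _ ->.
- by move=> s s' t t' _ -> _ ->.
- by move=> s s' t t' _ -> _ ->.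
- by move=> *; apply/funext => f; apply/funext => n; rewrite addrA.
- by move=> *; apply/funext => f; apply/funext => n; rewrite addrC.
- by move=> *; apply/funext => f; apply/funext => n; rewrite mul0r add0r.
- by move=> *; apply/funext => f; apply/funext => n; rewrite mulN1r addNr mul0r.
- by move=> *; apply/funext => f; apply/funext => n; rewrite mul1r.
- move=> t; apply/funext => f; congr verma.
  by apply/funext => n; rewrite mul1r.
- by move=> s t u; apply/funext => f; rewrite vermaD.
- by move=> a b; apply/funext => f; apply/funext => n; rewrite mulrDl.
- by move=> a b; apply/funext => f; apply/funext => n; rewrite mulrA.
- by move=> a t; apply/funext => f; rewrite vermaZ.
Qed.

Definition verma_act (x : Uq q) : (nat -> k) -> nat -> k := verma (prep x).

Lemma verma_act_pcl t : verma_act (pcl (uq_rel q) t) = verma t.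
Proof. by apply: verma_pcong; apply: prepP. Qed.

Lemma verma_actD (x y : Uq q) f n :
  verma_act (x + y) f n = verma_act x f n + verma_act y f n.
Proof. by rewrite [x + y]/(pcl _ _) verma_act_pcl. Qed.

Lemma verma_actM (x y : Uq q) f :
  verma_act (x * y) f = verma_act x (verma_act y f).
Proof. by rewrite [x * y]/(pcl _ _) verma_act_pcl. Qed.

Lemma verma_actZ1 c f n : verma_act (c%:A : Uq q) f n = c * f n.
Proof.
have -> : c%:A = pcl (uq_rel q) (c%:T * 1%:T)%pr :> Uq q.
  exact: pcl_scale.
by rewrite verma_act_pcl /= mul1r.
Qed.

Lemma verma_horner p :
  verma_act (horner_alg (uK q) p) (fun n => (n == 0)%:R) 0%N = p.[lam].
Proof.
elim/poly_ind: p => [|p c IH].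
  rewrite raddf0 horner0 -[0 : Uq q](scale0r 1) verma_actZ1 mul0r //.
rewrite horner_algMXaddC verma_actD verma_actM.
rewrite verma_actZ1 hornerMXaddC mulr1 -IH; congr (_ + _).
have -> : verma_act (uK q) (fun n => (n == 0)%:R) = fun n => lam * (n == 0)%:R.
  rewrite verma_act_pcl; apply/funext => -[|n] /=; last by rewrite !mulr0.
  by rewrite /verma_wt muln0 expr0 invr1 mulr1.
by rewrite {1}/verma_act vermaZ mulrC.
Qed.

End Verma.

Lemma horner_uK_inj (k : numFieldType) (q : k) (p : {poly k}) :
  q != 0 -> horner_alg (uK q) p = 0 -> p = 0.
Proof.
move=> q0 p0; apply/eqP; apply: contraT => pN0.
pose s := [seq n.+1%:R : k | n <- iota 0 (size p)].
have := @max_poly_roots _ p s pN0.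
rewrite size_map size_iota ltnn; apply.
  apply/allP => x /mapP[n _ ->]; apply/rootP.
  have n0 : n.+1%:R != 0 :> k by rewrite pnatr_eq0.
  rewrite -(verma_horner q0 n0) p0 -(raddf0 (horner_alg (uK q))).
  by rewrite verma_horner // horner0.
rewrite map_inj_uniq ?iota_uniq // => m n /eqP.
by rewrite eqr_nat eqSS => /eqP.
Qed.

Section Delta.
Variables (k : fieldType) (q : k).
Local Notation T := (tensor (Uq q) (Clp k)).

Definition delta_K : T :=
  q^-1 *: (uK q ⊗ 1) + (q - q^-1) *: (uK q ⊗ (cE0 k * cF0 k)).

Definition delta_Kinv : T :=
  q *: (uKinv q ⊗ 1) - (q - q^-1) *: (uKinv q ⊗ (cE0 k * cF0 k)).

Definition is_diag_embedding (delta : {lrmorphism Uqk q -> T}) : Prop :=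
  delta (kK q) = delta_K /\ delta (kKinv q) = delta_Kinv.

Lemma clp_rel s t : @cl_rel k s t -> pcl (@cl_rel k) s = pcl (@cl_rel k) t.
Proof. by move=> st; apply/pclP/pc_rel. Qed.

Lemma cFF : cF0 k * cF0 k = 0.
Proof. by rewrite /cF0 [LHS]pcl_mul (clp_rel (cl_ff k)). Qed.

Lemma cEF : cE0 k * cF0 k + cF0 k * cE0 k = 1.
Proof.
have -> : cE0 k * cF0 k = pcl (@cl_rel k) (tX gen_e * tX gen_f)%pr :> Clp k.
  exact: pcl_mul.
have -> : cF0 k * cE0 k = pcl (@cl_rel k) (tX gen_f * tX gen_e)%pr :> Clp k.
  exact: pcl_mul.
by rewrite [LHS]pcl_add (clp_rel (cl_ef k)).
Qed.

Lemma cEF_idem : cE0 k * cF0 k * (cE0 k * cF0 k) = cE0 k * cF0 k.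
Proof.
have -> : cE0 k * cF0 k * (cE0 k * cF0 k) = cE0 k * (cF0 k * cE0 k) * cF0 k.
  by rewrite !mulrA.
have -> : cF0 k * cE0 k = 1 - cE0 k * cF0 k by rewrite -cEF addrAC subrr add0r.
by rewrite mulrBr mulr1 mulrBl -!mulrA cFF !mulr0 subr0.
Qed.

Hypothesis q0 : q != 0.

Lemma delta_mul1 (x y : Uq q) (h := q - q^-1) (p := cE0 k * cF0 k) :
  x * y = 1 ->
  (q^-1 *: (x ⊗ 1) + h *: (x ⊗ p)) * (q *: (y ⊗ 1) - h *: (y ⊗ p)) = 1 :> T.
Proof.
move=> xy; rewrite mulrDl !mulrBr -!scalerAl -!scalerAr !tens_mul.
rewrite xy !(mul1r, mulr1) cEF_idem !scalerA mulVf // scale1r.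
rewrite -addrA -[RHS]addr0; congr (_ + _).
rewrite addrC -addrA -opprD -scalerDl -scalerBl -/p.
suff -> : h * q - (h * h + q^-1 * h) = 0 by rewrite scale0r.
by rewrite /h; ring.
Qed.

Lemma delta_mul2 (x y : Uq q) (h := q - q^-1) (p := cE0 k * cF0 k) :
  y * x = 1 ->
  (q *: (y ⊗ 1) - h *: (y ⊗ p)) * (q^-1 *: (x ⊗ 1) + h *: (x ⊗ p)) = 1 :> T.
Proof.
move=> yx; rewrite mulrDr !mulrBl -!scalerAl -!scalerAr !tens_mul.
rewrite yx !(mul1r, mulr1) cEF_idem !scalerA mulfV // scale1r.
rewrite -addrA -[RHS]addr0; congr (_ + _).
rewrite addrC -addrA -opprD -scalerDl -scalerBl -/p.
suff -> : q * h - (h * h + h * q^-1) = 0 by rewrite scale0r.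
by rewrite /h; ring.
Qed.

End Delta.

Lemma diag_embedding_exists (k : numFieldType) (q : k) : q != 0 ->
  exists delta : {lrmorphism Uqk q -> tensor (Uq q) (Clp k)},
    is_diag_embedding delta.
Proof.
move=> q0.
pose kx := delta_K q; pose ky := delta_Kinv q.
have KKi := uKKinv q; have KiK := uKinvK q.
have kxy : kx * ky = 1 by apply: delta_mul1.
have kyx : ky * kx = 1 by apply: delta_mul2.
pose num (u : Uqk q) := projT1 (cid (uqk_valP u)).
pose den (u : Uqk q) := projT1 (cid (projT2 (cid (uqk_valP u)))).
have repE u : val u = laurent (uK q) (uKinv q) (num u) (den u).
  exact: projT2 (cid (projT2 (cid (uqk_valP u)))).
pose d (u : Uqk q) := laurent kx ky (num u) (den u).
have dE u p m : val u = laurent (uK q) (uKinv q) p m -> d u = laurent kx ky p m.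
  rewrite repE => /(laurent_cross KKi KiK) e.
  have {}e : num u * 'X^m = p * 'X^(den u).
    apply/eqP; rewrite -subr_eq0; apply/eqP.
    by apply: (horner_uK_inj q0); rewrite raddfB /= e subrr.
  by rewrite /d (laurent_shift kxy kyx _ _ m) e addnC -(laurent_shift kxy kyx).
have dD : zmod_morphism d.
  move=> u v; rewrite -scaleN1r.
  rewrite (dE _ (num u * 'X^(den v) + (-1 *: num v) * 'X^(den u)) (den u + den v)%N).
    by rewrite -(laurentD kxy kyx) -laurentZ scaleN1r.
  by rewrite -(laurentD KKi KiK) -laurentZ -!repE !scaleN1r raddfB.
have dM : monoid_morphism d.
  split=> [|u v].
    by rewrite (dE _ 1 0%N) ?laurent1 // rmorph1.
  rewrite (dE _ (num u * num v) (den u + den v)%N).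
    by rewrite -(laurentM kxy kyx).
  by rewrite -(laurentM KKi KiK) -!repE rmorphM.
have dZ : scalable d.
  move=> c u; rewrite (dE _ (c *: num u) (den u)) -?laurentZ //.
  by rewrite -repE linearZ.
pose a := GRing.isZmodMorphism.Build _ _ d dD.
pose b := GRing.isMonoidMorphism.Build _ _ d dM.
pose c := GRing.isScalable.Build _ _ _ _ d dZ.
pose delta : {lrmorphism Uqk q -> tensor (Uq q) (Clp k)} := HB.pack d a b c.
exists delta; split.
  by rewrite /= (dE _ 'X 0%N) laurentX.
by rewrite /= (dE _ 1 1%N) laurentY.
Qed.

Definition casimir (k : fieldType) (q : k) : Uq q :=
  2 *: (uE q * uF q) +
  ((q - q^-1) ^+ 2)^-1 *:
    ((2 * q) *: uKinv q + (2 * q^-1) *: uK q - (2 * (q + q^-1))%:A).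

Definition casimir_k (k : fieldType) (q : k) : Uqk q :=
  ((q + q^-1) / (q - q^-1) ^+ 2) *: (kK q + kKinv q - 2).

Definition dirac (k : fieldType) (q : k) : tensor (Uq q) (Clp k) :=
  uE q ⊗ cF0 k + uF q ⊗ cE0 k.

(* Main.v *)
Require Import Defs.
From mathcomp Require Import all_boot all_order all_algebra.
From mathcomp Require Import reals complex.

Import GRing.Theory.
Local Open Scope ring_scope.

(** Write [e], [f] for [cE0], [cF0], put [h = q - q^-1] and let [p = e * f] be
    the idempotent that appears in the diagonal embedding. As [e] and [f] square
    to zero, the square of [E ⊗ f + F ⊗ e] has only the mixed terms
    [E F ⊗ f e + F E ⊗ e f]. The Clifford relation [f e = 1 - p] turns them into
    [E F ⊗ 1 - (E F - F E) ⊗ p], and the defining relation for the commutator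
    of [E] and [F] gives [dirac_sqr]:
     [D^2 = E F ⊗ 1 - h^-1 (K - K^-1) ⊗ p].

    On the other side, half the Casimir element is [E F] plus [h^-2] times
    [q K^-1 + q^-1 K - (q + q^-1)], while [delta_sum] says that
    [delta (K + K^-1)] is [(q K^-1 + q^-1 K) ⊗ 1 + h (K - K^-1) ⊗ p]. Subtracting
    [h^-2 delta (K + K^-1 - 2)] from the former cancels [q K^-1 + q^-1 K], leaves
    [- h^-1 (K - K^-1) ⊗ p], and produces the scalar [2 - (q + q^-1)] over [h^2],
    which the constant term of the theorem compensates. Since [casimir_k] is
    [h^-2 (K + K^-1 - 2)] times [q + q^-1], this single identity,
    [dirac_sqr_delta], covers both cases of the theorem. *)

Section PureTensors.
Variables (k : fieldType) (A B : lmodType k).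

Lemma tensDl (a a' : A) (b : B) : (a + a') ⊗ b = a ⊗ b + a' ⊗ b.
Proof. by rewrite [RHS]tcl_add; apply/tclP/tc_Dl. Qed.

Lemma tensDr (a : A) (b b' : B) : a ⊗ (b + b') = a ⊗ b + a ⊗ b'.
Proof. by rewrite [RHS]tcl_add; apply/tclP/tc_Dr. Qed.

Lemma tensZl c (a : A) (b : B) : (c *: a) ⊗ b = c *: (a ⊗ b).
Proof. by rewrite [RHS]tcl_scale. Qed.

Lemma tensZr c (a : A) (b : B) : a ⊗ (c *: b) = c *: (a ⊗ b).
Proof. by rewrite -tensZl; apply/esym/tclP/tc_Z. Qed.

Lemma tensBl (a a' : A) (b : B) : (a - a') ⊗ b = a ⊗ b - a' ⊗ b.
Proof. by rewrite tensDl -scaleN1r tensZl scaleN1r. Qed.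

Lemma tensBr (a : A) (b b' : B) : a ⊗ (b - b') = a ⊗ b - a ⊗ b'.
Proof. by rewrite tensDr -scaleN1r tensZr scaleN1r. Qed.

Lemma tens0r (a : A) : a ⊗ (0 : B) = 0.
Proof. by rewrite -(subrr (0 : B)) tensBr subrr. Qed.

End PureTensors.

Section DiracSquare.
Variables (k : fieldType) (q : k).
Local Notation T := (tensor (Uq q) (Clp k)).
Local Notation h := (q - q^-1).
Local Notation p := (cE0 k * cF0 k).

Lemma cEE : cE0 k * cE0 k = 0.
Proof. by rewrite /cE0 [LHS]pcl_mul (clp_rel (cl_ee k)). Qed.

Lemma uq_commutator : uE q * uF q - uF q * uE q = h^-1 *: (uK q - uKinv q).
Proof.
have subE s t : pcl (uq_rel q) s - pcl (uq_rel q) t = pcl (uq_rel q) (s - t)%pr.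
  by rewrite [- _]pcl_opp [LHS]pcl_add.
by rewrite [_ * uF q]pcl_mul [_ * uE q]pcl_mul !subE (pcl_rel (uq_EF q)) -pcl_scale.
Qed.

Lemma dirac_sqr :
  dirac q ^+ 2 = (uE q * uF q) ⊗ 1 - h^-1 *: ((uK q - uKinv q) ⊗ p) :> T.
Proof.
have fe : cF0 k * cE0 k = 1 - p by rewrite -cEF addrAC subrr add0r.
rewrite expr2 /dirac mulrDl !mulrDr !tens_mul cFF cEE !tens0r add0r addr0.
by rewrite fe tensBr -tensZl -uq_commutator tensBl opprB addrA [LHS]addrAC.
Qed.

(** The [p]-parts of [delta_K] and [delta_Kinv] have opposite signs, so that they
    add up to [h ^+ 2] times the commutator of [E] and [F] tensored with [p],
    the second term of [dirac_sqr] up to a scalar. *)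
Lemma delta_sum :
  delta_K q + delta_Kinv q =
    (q *: uKinv q + q^-1 *: uK q) ⊗ 1 + h *: ((uK q - uKinv q) ⊗ p) :> T.
Proof.
rewrite /delta_K /delta_Kinv tensBl tensDl !tensZl [h *: (_ - _)]scalerBr.
by rewrite addrACA [q^-1 *: _ + _]addrC.
Qed.

Hypothesis two_neq0 : (2 : k) != 0.

Lemma half_casimir : 2^-1 *: casimir q =
  uE q * uF q +
  (h ^+ 2)^-1 *: (q *: uKinv q + q^-1 *: uK q - (q + q^-1)%:A) :> Uq q.
Proof.
rewrite /casimir -!(scalerA 2) -!scalerDr -scalerBr.
by rewrite scalerA mulrC -scalerA -scalerDr scalerA mulVf ?scale1r.
Qed.

(** Stating the identity with [K + K^-1 - 2] instead of [casimir_k] avoids the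
    division by [q + q^-1]. *)
Lemma dirac_sqr_delta (delta : {lrmorphism Uqk q -> T}) :
  is_diag_embedding delta ->
  dirac q ^+ 2 =
    2^-1 *: (casimir q ⊗ 1)
    - delta ((h ^+ 2)^-1 *: (kK q + kKinv q - 2))
    + ((q + q^-1 - 2) / h ^+ 2)%:A ⊗ 1.
Proof.
move=> [dK dKi].
rewrite linearZ rmorphB rmorphD rmorph_nat /= dK dKi delta_sum dirac_sqr.
set Z := _ ⊗ p.
rewrite -[2^-1 *: _]tensZl half_casimir tensDl tensZl tensBl.
set Y := (_ + _) ⊗ 1.
rewrite !tensZl [_ / _]mulrC -scalerA.
have -> : (1 : Uq q) ⊗ (1 : Clp k) = 1 by [].
rewrite -2!addrA; congr (_ + _).
rewrite -!scalerN -!scalerDr.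
(* Both sides vanish if [h = 0], by the convention [0^-1 = 0]. *)
have -> : h^-1 = (h ^+ 2)^-1 * h.
  by have [->|h0] := eqVneq h 0; rewrite ?invr0 ?mulr0 // expr2 invfM mulfVK.
rewrite -scalerA; congr (_ *: _).
rewrite !scalerN addrA [(_ - 2)%:A]scalerBl scaler_nat.
by rewrite opprB [2 - _]addrC addrACA subrK addrK opprD addNKr.
Qed.

End DiracSquare.

Theorem proposition2p18 (R : realType) (q : R[i])
    (q_neq0 : q != 0) (q_neq1 : q != 1) (q_neqN1 : q != - 1)
    (delta : {lrmorphism Uqk q -> tensor (Uq q) (Clp R[i])})
    (delta_diag : is_diag_embedding delta) :
  (q + q^-1 != 0 ->
    dirac q ^+ 2 =
      2^-1 *: (casimir q ⊗ 1)
      - (q + q^-1)^-1 *: delta (casimir_k q)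
      + ((q + q^-1 - 2) / (q - q^-1) ^+ 2)%:A ⊗ 1)
  /\
  (* For q = i or q = -i the scalar 1 / (q + q^-1) is to be read together with
     the factor q + q^-1 of casimir_k, which it cancels. *)
  (q + q^-1 = 0 ->
    dirac q ^+ 2 =
      2^-1 *: (casimir q ⊗ 1)
      - delta (((q - q^-1) ^+ 2)^-1 *: (kK q + kKinv q - 2))
      + ((q + q^-1 - 2) / (q - q^-1) ^+ 2)%:A ⊗ 1).
Proof.
have two_neq0 : (2 : R[i]) != 0 by rewrite Num.Theory.pnatr_eq0.
have main := dirac_sqr_delta _ q two_neq0 delta delta_diag.
split=> [s_neq0|_]; last exact: main.
by rewrite main /casimir_k -linearZ /= scalerA mulrA mulVf // mul1r.
Qed.
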